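(* There exist absolute constants $C\geq 1$ and $c_0>0$ such that the following holds. Let $X,Y,Z$ be finite $1$-separated subsets of a metric group $G$, let $0<\delta<1/100$, let $0<\epsilon<c_0$, and suppose that $|Z|\leq\delta^{-1}|X|^{1/2}|Y|^{1/2}$ and that $d(xy,Z)\leq\epsilon$ for at least $\delta|X||Y|$ pairs $(x,y)\in X\times Y$. Then there exist subsets $X''\subset X$, $Y''\subset Y$ and $Z''\subset Z$ with $|X''|\geq\delta^{C}|X|$, $|Y''|\geq\delta^{C}|Y|$ and $|Z''|\geq\delta^{C}|Z|$, a $(\delta^{-C},C\epsilon)$-rough approximate subgroup $H\subset G$, and elements $u,v,w\in G$ such that $\nu_{C\epsilon}(H)\leq\delta^{-C}|X|^{1/2}|Y|^{1/2}$, $X''\subset(uH)_{C\epsilon}$, $Y''\subset(Hv)_{C\epsilon}$, $Z''\subset(X''Y'')_\epsilon\cap(uwHv)_{C\epsilon}$, and $d(xy,Z'')\leq\epsilon$ for at least $\delta^{C}|X''||Y''|$ pairs $(x,y)\in X''\times Y''$.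
   Context: A metric group is a group with a bi-invariant metric $d$ (possibly taking the value $+\infty$). A set is $1$-separated if its distinct elements are at distance at least $1$. For $U\subset G$, $U_\eta=\{g:d(g,U)\leq\eta\}$. $\nu_\eta(S)$ is the smallest size of a set $\Delta$ such that every $s\in S$ has $t\in\Delta$ with $d(s,t)<\eta$. A subset $H$ is a $(k,\eta)$-rough approximate subgroup if there is a set $K$ of size at most $k$ with $HH\subset(KH)_\eta$.
   Formalization: X and Y are assumed nonempty; if X is empty and Y is not, the hypotheses hold with Z empty, but the conclusion would require H to be both empty (covering number 0) and nonempty (to contain Y'' near Hv). *)

(* Defs.v *)
From HB Require Import structures.
From mathcomp Require Import all_boot all_order all_algebra.
From mathcomp Require Import finmap.
From mathcomp Require Import all_classical all_reals ereal exp.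

Set Implicit Arguments.
Unset Strict Implicit.
Unset Printing Implicit Defensive.

Local Open Scope classical_set_scope.
Local Open Scope ring_scope.
Local Open Scope ereal_scope.

Record biinvariant_metric (R : realType) (G : groupType) (d : G -> G -> \bar R)
    : Prop := BiinvariantMetric {
  metric_ge0 : forall x y, 0 <= d x y ;
  metric_eq0 : forall x y, d x y = 0 <-> x = y ;
  metric_sym : forall x y, d x y = d y x ;
  metric_triangle : forall x y z, d x z <= d x y + d y z ;
  metric_mul2l : forall g x y, d (g * x)%g (g * y)%g = d x y ;
  metric_mul2r : forall g x y, d (x * g)%g (y * g)%g = d x y
}.

Definition mulset (G : groupType) (A B : set G) : set G :=
  [set (a * b)%g | a in A & b in B].

Section MetricNotions.
Context {R : realType} {G : groupType}.
Variable d : G -> G -> \bar R.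

Definition one_separated (A : {fset G}) : Prop :=
  forall x y, x \in A -> y \in A -> x <> y -> 1 <= d x y.

(* As ereal_inf set0 = +oo, every point is at distance +oo from the empty set. *)
Definition dist_to (g : G) (U : set G) : \bar R := ereal_inf [set d g u | u in U].

Definition nbhd (eta : R) (U : set G) : set G := [set g | dist_to g U <= eta%:E].

(* The value is +oo when S has no finite eta-net; otherwise the infimum of this
   set of natural numbers is attained. The net need not be contained in S. *)
Definition covering_number (eta : R) (S : set G) : \bar R :=
  ereal_inf [set (#|` D|%:R)%:E | D in
    [set D : {fset G} | forall s, S s -> exists2 t, t \in D & d s t < eta%:E]].

Definition rough_approx_subgroup (k eta : R) (H : set G) : Prop :=
  exists K : {fset G},
    (#|` K|%:R <= k)%R /\ mulset H H `<=` nbhd eta (mulset [set` K] H).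

Definition close_pairs (eps : R) (X Y Z : {fset G}) : {fset G * G} :=
  [fset p in (X `*` Y)%fset | dist_to (p.1 * p.2)%g [set` Z] <= eps%:E]%fset.

End MetricNotions.

(* Main.v *)
(* Write N = |Z|; the hypotheses force |X| and |Y| to be comparable to N up to
   powers of delta. Join x to y when xy is eps-close to Z and label the edge by a
   nearby z. Dependent random choice in this graph gives B in Y such that every
   b^-1 b' (b, b' in B) is close to delta^O(1) N^3 words z1^-1 z2 z3^-1 z4. Let S be
   the set of the g that are close to b b'^-1 for at least delta^25 N pairs of
   elements of B. For b, b' in B and g in S^n, chaining gives b^-1 g b' a number
   delta^O(n) N^(4n+3) of words of length 4n+4, so a separated subset of S^n has at
   most delta^-O(n) N elements. Counting pairs of edges with equal labels yields u
   in X and a large A in X with A in uS. Hence S^2 is a rough approximate subgroup,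
   by Ruzsa's covering argument applied to S^4 and the separated set u^-1 A.
   Counting again the pairs of edges with equal labels, now with one endpoint in A,
   gives v and a large D in Y close to S^2 v; the pigeonhole principle over the
   translates covering S^4 then provides w. *)
Require Import Defs.
From HB Require Import structures.
From mathcomp Require Import all_boot all_order all_algebra.
From mathcomp Require Import ring lra.

Set Implicit Arguments.
Unset Strict Implicit.
Unset Printing Implicit Defensive.

Import Order.TTheory GRing.Theory Num.Theory.
Local Open Scope ring_scope.

(** * Counting in finite types *)

Section FiniteCounting.
Context {R : realFieldType}.

Lemma sum_ge_exists (I : finType) (A : {set I}) (f : I -> R) (c : R) :
  A != set0 -> c * #|A|%:R <= \sum_(i in A) f i -> exists2 i, i \in A & c <= f i.
Proof.
move=> A0 h; apply/exists_inP; apply: contraT; rewrite negb_exists_in.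
move=> /forall_inP f_lt; move: h; rewrite leNgt; case/negP.
rewrite mulr_natr -sumr_const; apply: ltr_sum => //.
- by case/set0Pn: A0 => i iA; apply/hasP; exists i; rewrite ?mem_index_enum.
- by move=> i iA; rewrite ltNge f_lt.
Qed.

(** Cauchy-Schwarz against the constant function, read off from the nonnegativity of the sum of
    squared deviations from the mean [t]. *)
Lemma sqr_sum_le (I : finType) (f : I -> R) :
  (\sum_i f i) ^+ 2 <= #|I|%:R * \sum_i f i ^+ 2.
Proof.
have [I0|I0] := eqVneq #|I| 0%N.
  rewrite big_pred0 ?expr0n ?I0 ?mul0r //= => i.
  by have := fintype0 i I0.
have n0 : 0 < #|I|%:R :> R by rewrite ltr0n lt0n.
set t := (\sum_i f i) / #|I|%:R.
have : 0 <= \sum_i (f i - t) ^+ 2 by apply: sumr_ge0 => i _; exact: sqr_ge0.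
under eq_bigr do rewrite sqrrB -mulrnAl -mulr_natl.
rewrite big_split sumrB /= -mulr_suml -mulr_sumr sumr_const -[X in _ + X]mulr_natl.
have -> : \sum_i f i = t * #|I|%:R by rewrite /t mulfVK ?gt_eqF.
rewrite -(ler_pM2l n0) mulr0 -/t (_ : #|xpredT| = #|I|) //.
move: (#|I|%:R : R) (\sum_i f i ^+ 2) => n q; nra.
Qed.

Lemma card_pairs (I J : finType) (r : I -> J -> bool) :
  #|[set p : I * J | r p.1 p.2]| = (\sum_i #|[set j | r i j]|)%N.
Proof.
rewrite -sum1_card big_mkcond (eq_bigr (fun p => nat_of_bool (r p.1 p.2))); last first.
  by move=> p _; rewrite inE; case: (r _ _).
rewrite -(pair_bigA _ (fun i j => nat_of_bool (r i j))) /=.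
apply: eq_bigr => i _; rewrite -sum1_card [RHS]big_mkcond /=.
by apply: eq_bigr => j _; rewrite inE; case: (r _ _).
Qed.

Lemma card_pairs_swap (I J : finType) (r : I -> J -> bool) :
  #|[set p : I * J | r p.1 p.2]| = (\sum_j #|[set i | r i j]|)%N.
Proof.
have cardE (K : finType) (q : pred K) : #|[set k | q k]| = (\sum_k nat_of_bool (q k))%N.
  rewrite -sum1_card big_mkcond; apply: eq_bigr => k _.
  by rewrite inE; case: (q k).
rewrite card_pairs (eq_bigr _ (fun i _ => cardE J (r i))) exchange_big /=.
by apply: eq_bigr => j _; rewrite (cardE I (r^~ j)).
Qed.

Lemma sum_card_disjoint (I J : finType) (A : {set I}) (F : I -> {set J}) (D : {set J}) :
  (forall i, i \in A -> F i \subset D) ->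
  (forall i i' j, i \in A -> i' \in A -> j \in F i -> j \in F i' -> i = i') ->
  (\sum_(i in A) #|F i| <= #|D|)%N.
Proof.
move=> sub inj.
pose r i j := (i \in A) && (j \in F i).
have -> : (\sum_(i in A) #|F i|)%N = #|[set p | r p.1 p.2]|.
  rewrite card_pairs big_mkcond; apply: eq_bigr => i _; rewrite /r.
  case: (i \in A) => /=; first by apply: eq_card => j; rewrite inE.
  by rewrite (_ : [set _ | _] = set0) ?cards0 //; apply/setP=> j; rewrite !inE.
rewrite -(@card_in_imset _ _ snd) => [|[i j] [i' j']]; last first.
  rewrite !inE /r /= => /andP[iA ji] /andP[i'A ji'] jj'.
  by rewrite -jj' in ji' *; rewrite (inj i i' j).
apply/subset_leq_card/subsetP => _ /imsetP[[i j]] /[!inE] /andP[iA ji] ->.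
exact: (subsetP (sub i iA)).
Qed.

(** Cauchy-Schwarz over the fibres of [lab]: the squares of the fibres are disjoint sets of
    colliding pairs. *)
Lemma card_collisions (I J : finType) (F : {set I}) (lab : I -> J) :
  #|F|%:R ^+ 2 <= #|J|%:R *
    #|[set p : I * I | [&& p.1 \in F, p.2 \in F & lab p.1 == lab p.2]]|%:R :> R.
Proof.
pose fib j := [set i in F | lab i == j].
have FE : #|F|%:R = \sum_j #|fib j|%:R :> R.
  rewrite -natr_sum -sum1_card (partition_big lab xpredT) //=; congr _%:R.
  apply: eq_bigr => j _; rewrite -sum1_card; apply: eq_bigl => i.
  by rewrite inE.
rewrite FE; apply: (le_trans (sqr_sum_le _)).
rewrite ler_wpM2l //.
under eq_bigr do rewrite -natrX -mulnn -cardsX.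
rewrite -natr_sum ler_nat.
have -> : (\sum_j #|setX (fib j) (fib j)|)%N =
    (\sum_(j in [set: J]) #|setX (fib j) (fib j)|)%N.
  by apply: eq_bigl => j; rewrite inE.
apply: sum_card_disjoint => [j _|j j' [a b] _ _].
  apply/subsetP => -[a b] /[!inE] /= /andP[/andP[-> /eqP->] /andP[-> /eqP->]].
  by rewrite eqxx.
by rewrite !inE /= => /andP[/andP[_ /eqP<-] _] /andP[/andP[_ /eqP<-] _].
Qed.

(** Pigeonhole for a relation instead of a function: every [i] in [F] is counted at least once among
    the fibres, and overlaps only help. *)
Lemma popular_fibre (I J : finType) (F : {set I}) (r : J -> I -> bool) :
  (0 < #|J|)%N -> (forall i, i \in F -> exists j, r j i) ->
  exists j, #|F|%:R <= #|J|%:R * #|[set i in F | r j i]|%:R :> R.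
Proof.
move=> J0 rF; have j0 : 0 < #|J|%:R :> R by rewrite ltr0n.
have [||j _ hj] := @sum_ge_exists J [set: J] (fun j => #|[set i in F | r j i]|%:R)
  (#|F|%:R / #|J|%:R); last first.
- by exists j; rewrite mulrC -ler_pdivrMr.
- rewrite (eq_bigl xpredT) => [|j]; last by rewrite inE.
  rewrite cardsT mulfVK ?gt_eqF // -natr_sum ler_nat.
  rewrite -(card_pairs (fun j i => (i \in F) && r j i)).
  rewrite (card_pairs_swap (fun j i => (i \in F) && r j i)) -sum1_card big_mkcond /=.
  apply: leq_sum => i _; case: ifP => // iF; have [j rj] := rF i iF.
  by rewrite card_gt0; apply/set0Pn; exists j; rewrite inE.
- by rewrite -card_gt0 cardsT.
Qed.

End FiniteCounting.

(** * Dependent random choice *)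

Section DependentChoice.
Context {R : realFieldType} {X Y : finType} (E : X -> Y -> bool).

Definition degree (y : Y) := #|[set x | E x y]|.
Definition codegree (y y' : Y) := #|[set x | E x y && E x y']|.

Lemma codegreeC y y' : codegree y y' = codegree y' y.
Proof. by apply: eq_card => x; rewrite !inE andbC. Qed.

(* Take for V the high-degree neighbours of a random x: a pair of small codegree
   is unlikely to survive, so few pairs of V are bad. B keeps the elements of V
   that are bad with at most a quarter of V. *)
Lemma dependent_choice (delta : R) :
  (0 < #|X|)%N -> (0 < #|Y|)%N -> 0 < delta ->
  delta * #|X|%:R * #|Y|%:R <= #|[set p | E p.1 p.2]|%:R ->
  exists V B : {set Y},
    [/\ delta / 3 * #|Y|%:R <= #|V|%:R, #|V|%:R / 2 <= #|B|%:R :> R,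
        forall y, y \in B -> delta / 2 * #|X|%:R <= (degree y)%:R
      & forall b b', b \in B -> b' \in B ->
          #|V|%:R / 2 <= #|[set y in V |
            (delta ^+ 2 / 128 * #|X|%:R <= (codegree b y)%:R) &&
            (delta ^+ 2 / 128 * #|X|%:R <= (codegree y b')%:R)]|%:R :> R].
Proof.
move=> X0 Y0 d0 hE.
have x0 : 0 < #|X|%:R :> R by rewrite ltr0n.
have y0 : 0 < #|Y|%:R :> R by rewrite ltr0n.
pose T := [set y | delta / 2 * #|X|%:R <= (degree y)%:R].
pose N x := [set y | (y \in T) && E x y].
(* Vertices outside [T] carry at most [delta / 2 * #|X| * #|Y|] edges, so at least half of the
   guaranteed edges end in [T]. *)
have h1 : delta / 2 * #|X|%:R * #|Y|%:R <= \sum_x #|N x|%:R.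
  suff : #|[set p | E p.1 p.2]|%:R <=
      \sum_x #|N x|%:R + delta / 2 * #|X|%:R * #|Y|%:R by lra.
  rewrite card_pairs_swap -natr_sum.
  rewrite -(card_pairs (fun x y => (y \in T) && E x y)).
  rewrite (card_pairs_swap (fun x y => (y \in T) && E x y)).
  rewrite !natr_sum [_ * #|Y|%:R]mulr_natr -sumr_const -big_split /=.
  apply: ler_sum => y _; case: (boolP (y \in T)) => /= yT.
    by apply: ler_wpDr; rewrite ?lexx // mulr_ge0 ?divr_ge0 ?ler0n // ltW.
  rewrite ler_wpDl ?ler0n //; move: yT; rewrite inE -ltNge; exact: ltW.
have h2 : delta ^+ 2 / 4 * #|X|%:R * #|Y|%:R ^+ 2 <= \sum_x #|N x|%:R ^+ 2.
  have := sqr_sum_le (fun x => #|N x|%:R : R).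
  have : (delta / 2 * #|X|%:R * #|Y|%:R) ^+ 2 <= (\sum_x #|N x|%:R) ^+ 2.
    apply: lerXn2r h1; rewrite nnegrE; last exact: sumr_ge0.
    by rewrite !mulr_ge0 ?invr_ge0 // ltW.
  move=> /le_trans h /h le_sqr; rewrite -(ler_pM2l x0); apply: le_trans le_sqr.
  by rewrite le_eqVlt; apply/orP; left; apply/eqP; field.
pose bad y y' := (codegree y y')%:R < delta ^+ 2 / 128 * #|X|%:R :> R.
pose nbad x := #|[set q : Y * Y | [&& q.1 \in N x, q.2 \in N x & bad q.1 q.2]]|.
(* A bad pair lies in [N x] only when [x] is one of its few common neighbours. *)
have h3 : \sum_x (nbad x)%:R <= delta ^+ 2 / 128 * #|X|%:R * #|Y|%:R ^+ 2.
  rewrite -natr_sum.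
  rewrite -(card_pairs (fun x q => [&& q.1 \in N x, q.2 \in N x & bad q.1 q.2])).
  rewrite (card_pairs_swap (fun x q => [&& q.1 \in N x, q.2 \in N x & bad q.1 q.2])).
  rewrite natr_sum -natrX -mulnn -card_prod mulr_natr -sumr_const.
  apply: ler_sum => -[y y'] _ /=; case: (boolP (bad y y')) => [|_].
    move=> /ltW; apply: le_trans; rewrite ler_nat; apply/subset_leq_card/subsetP.
    by move=> x /[!inE] /and3P[/andP[_ ->] /andP[_ ->] _].
  rewrite (_ : [set _ | _] = set0) ?cards0.
    by rewrite !mulr_ge0 ?ler0n ?invr_ge0 ?exprn_ge0 ?ler0n // ltW.
  by apply/setP => x; rewrite !inE !andbF.
(* The weight 16 turns [1 / 128] into [1 / 8], half of the [1 / 4] in [h2]. At the chosen [x] one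
   inequality then gives two facts: [#|V|] exceeds [delta / 3 * #|Y|], as [1 / 9 < 1 / 8], and at
   most [#|V| ^ 2 / 16] pairs of [V] are bad. *)
have [||x _] := @sum_ge_exists R X [set: X]
  (fun x => #|N x|%:R ^+ 2 - 16 * (nbad x)%:R) (delta ^+ 2 / 8 * #|Y|%:R ^+ 2).
- by rewrite -card_gt0 cardsT.
- rewrite (eq_bigl xpredT) => [|x]; last by rewrite inE.
  by rewrite sumrB -mulr_sumr cardsT; nra.
set V := N x => hV.
pose B := [set y in V | #|[set y' in V | bad y y']|%:R <= #|V|%:R / 4 :> R].
have nb0 : 0 <= (nbad x)%:R :> R by rewrite ler0n.
have V0 : 0 < #|V|%:R :> R.
  have : 0 < delta ^+ 2 / 8 * #|Y|%:R ^+ 2.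
    by rewrite mulr_gt0 ?exprn_gt0 ?divr_gt0 ?exprn_gt0.
  move=> pos; rewrite lt0r ler0n andbT; apply/eqP => V0.
  by move: hV; rewrite V0 expr0n /=; lra.
have BV : B \subset V by apply/subsetP => y; rewrite inE => /andP[].
exists V, B; split.
- rewrite leNgt; apply/negP => h.
  have : #|V|%:R ^+ 2 < (delta / 3 * #|Y|%:R) ^+ 2.
    rewrite ltrXn2r ?nnegrE ?ltW //; exact: lt_trans h.
  have : 0 < delta ^+ 2 * #|Y|%:R ^+ 2 by rewrite mulr_gt0 ?exprn_gt0.
  by lra.
- have : #|V :\: B|%:R * (#|V|%:R / 4) <= (nbad x)%:R :> R.
    rewrite /nbad (card_pairs (fun y y' => [&& y \in V, y' \in V & bad y y'])) natr_sum.
    rewrite mulr_natl -sumr_const [leRHS](bigID (mem (V :\: B))) /=.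
    rewrite ler_wpDr ?sumr_ge0 //; apply: ler_sum => y /[!inE].
    rewrite negb_and -ltNge => /andP[/orP[|+]].
      by move=> /negbTE ->.
    move=> /ltW h yV; apply: (le_trans h); rewrite ler_nat.
    by apply/subset_leq_card/subsetP => y'; rewrite !inE yV.
  have := cardsD V B; rewrite (setIidPr BV) => /(congr1 (fun n : nat => n%:R : R)).
  rewrite natrB ?subset_leq_card // => ->.
  have : 0 < delta ^+ 2 / 8 * #|Y|%:R ^+ 2.
    by rewrite mulr_gt0 ?exprn_gt0 ?divr_gt0 ?exprn_gt0.
  by nra.
- by move=> y /(subsetP BV); rewrite !inE => /andP[].
move=> b b'; rewrite !inE => /andP[_ hb] /andP[_ hb'].
set D := [set y in V | _].
have : (#|V| <= #|D| + #|[set y' in V | bad b y']| + #|[set y' in V | bad b' y']|)%N.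
  rewrite -addnA; apply: leq_trans (leq_add (leqnn _) (leq_card_setU _ _)).
  apply: leq_trans (leq_card_setU _ _); apply/subset_leq_card/subsetP => y yV.
  by move: yV; rewrite !inE => ->; rewrite /= /bad !ltNge (codegreeC y) -negb_and orbN.
rewrite -(ler_nat R) !natrD; lra.
Qed.
End DependentChoice.

From mathcomp Require Import finmap.
From mathcomp Require Import all_classical all_reals ereal exp.

(** * Closeness and representations by words *)

Section Closeness.
Context {R : realType} {G : groupType} (d : G -> G -> \bar R).
Hypothesis d_metric : biinvariant_metric d.

Definition close (r : R) (x y : G) : bool := (d x y <= r%:E)%E.

Lemma closexx r x : 0 <= r -> close r x x.
Proof. by move=> r0; rewrite /close (Defs.metric_eq0 d_metric x x).2 // lee_fin. Qed.

Lemma close_sym r x y : close r x y = close r y x.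
Proof. by rewrite /close (Defs.metric_sym d_metric). Qed.

Lemma close_le r s x y : r <= s -> close r x y -> close s x y.
Proof. by move=> rs /le_trans; apply; rewrite lee_fin. Qed.

Lemma close_trans y r s x z : close r x y -> close s y z -> close (r + s) x z.
Proof.
move=> xy yz; apply: (le_trans (Defs.metric_triangle d_metric x y z)).
by rewrite EFinD; apply: leeD.
Qed.

Lemma close_mul2l g r x y : close r (g * x)%g (g * y)%g = close r x y.
Proof. by rewrite /close (Defs.metric_mul2l d_metric). Qed.

Lemma close_mul2r g r x y : close r (x * g)%g (y * g)%g = close r x y.
Proof. by rewrite /close (Defs.metric_mul2r d_metric). Qed.

Lemma close_mul r s x y x' y' :
  close r x y -> close s x' y' -> close (r + s) (x * x')%g (y * y')%g.
Proof.
by move=> xy xy'; apply: (@close_trans (y * x')%g); rewrite ?close_mul2r ?close_mul2l.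
Qed.

Lemma close_inv r x y : close r x^-1%g y^-1%g = close r x y.
Proof.
by rewrite -(close_mul2l x) mulgV -(close_mul2r y) mulgVK mul1g close_sym.
Qed.

Lemma close_divl r x y z : close r (x * y)%g z = close r x (z * y^-1)%g.
Proof. by rewrite -(close_mul2r y^-1%g) mulgK. Qed.

Lemma close_divr r x y z : close r (x * y)%g z = close r y (x^-1 * z)%g.
Proof. by rewrite -(close_mul2l x^-1%g) mulKg. Qed.

Section Representations.
Context {I : finType} (w : I -> G).

Definition reps (r : R) (g : G) : {set I} := [set i | close r (w i) g]%SET.

Lemma reps_close r g h i : i \in reps r g -> i \in reps r h -> close (r + r) g h.
Proof. by rewrite !inE => ig ih; apply: close_trans ih; rewrite close_sym. Qed.

(** A word within [r] of two points makes them [r + r] close, so the representation sets of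
    separated points are disjoint inside [I]. *)
Lemma packing_bound (L : finType) (c : L -> G) (r a : R) :
  (forall l l', close (r + r) (c l) (c l') -> l = l') ->
  (forall l, a <= #|reps r (c l)|%:R) -> #|L|%:R * a <= #|I|%:R.
Proof.
move=> inj ge; apply: (@le_trans _ _ (\sum_l #|reps r (c l)|%:R)).
  by rewrite mulr_natl -sumr_const; apply: ler_sum.
rewrite -natr_sum ler_nat -cardsT.
rewrite (eq_bigl (mem [set: L]%SET)) => [|l]; last by rewrite /= inE.
apply: sum_card_disjoint => [l _|l l' i _ _ il il']; first exact: finset.subsetT.
by apply: inj; exact: reps_close il il'.
Qed.

End Representations.

Definition wmul (I J : Type) (w : I -> G) (w' : J -> G) (p : I * J) : G :=
  (w p.1 * w' p.2)%g.

(* The word [i] alone determines [c l] up to [r + r], hence [l]: the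
   representations obtained from different [l] are different. *)
Lemma reps_wmul (I J L : finType) (w : I -> G) (w' : J -> G) (c c' : L -> G)
    (A : {set L}) (r r' s a a' : R) (g h k : G) : 0 <= a -> 0 <= a' ->
  (forall l l', l \in A -> l' \in A -> close (r + r) (c l) (c l') -> l = l') ->
  (forall l, l \in A -> close s (c l * (c' l)^-1)%g k) ->
  (forall l, l \in A -> a <= #|reps w r (g * c l)%g|%:R) ->
  (forall l, l \in A -> a' <= #|reps w' r' ((c' l)^-1 * h)%g|%:R) ->
  #|A|%:R * (a * a') <= #|reps (wmul w w') (r + r' + s) (g * k * h)%g|%:R.
Proof.
move=> a0 a'0 inj ck ge ge'.
apply: (@le_trans _ _ (\sum_(l in A)
    #|finset.setX (reps w r (g * c l)%g) (reps w' r' ((c' l)^-1 * h)%g)|%:R)).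
  rewrite mulr_natl -sumr_const; apply: ler_sum => l lA.
  by rewrite cardsX natrM ler_pM ?ge ?ge'.
rewrite -natr_sum ler_nat; apply: sum_card_disjoint => [l lA|l l' [i j] lA l'A].
  apply/fintype.subsetP => -[i j]; rewrite !inE /= => /andP[wi wj].
  apply: (@close_trans (g * c l * ((c' l)^-1 * h))%g); first exact: close_mul.
  by rewrite mulgA close_mul2r -mulgA close_mul2l ck.
rewrite !finset.in_setX /= => /andP[il _] /andP[il' _]; apply: inj => //.
by rewrite -(close_mul2l g); exact: reps_close il il'.
Qed.

(** * Words and chaining *)

Section Words.
Context {J : finType} (w : J -> G).

(** The index is one less than the number of letters: [word n] has [n + 1] of them, and there is no
    empty word. *)
Fixpoint word (n : nat) : finType := if n is m.+1 then (word m * J)%type else J.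

Fixpoint wordv (n : nat) : word n -> G :=
  if n is m.+1 return word n -> G then wmul (wordv (n := m)) w else w.

Lemma card_word n : #|word n| = (#|J| ^ n.+1)%N.
Proof. by elim: n => [|n IH]; rewrite ?expn1 //= card_prod IH [RHS]expnSr. Qed.

End Words.

Fixpoint power (S : G -> Prop) (n : nat) (g : G) : Prop :=
  if n is m.+1 then exists h s, [/\ power S m h, S s & g = (h * s)%g] else g = 1%g.

Lemma power_mul (S : G -> Prop) m n g h :
  power S m g -> power S n h -> power S (m + n) (g * h)%g.
Proof.
move=> mg; elim: n h => [h ->|n IH _ [h [s [nh Ss ->]]]]; first by rewrite addn0 mulg1.
by rewrite addnS mulgA; exists (g * h)%g, s; split => //; exact: IH.
Qed.

Lemma power1 (S : G -> Prop) s : S s -> power S 1 s.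
Proof. by move=> Ss; exists 1%g, s; rewrite mul1g. Qed.

Lemma power_le (S : G -> Prop) m n g : S 1%g -> (m <= n)%N -> power S m g -> power S n g.
Proof.
move=> S1 /subnK <- mg; elim: (n - m)%N => [//|k IH].
by exists g, 1%g; rewrite mulg1.
Qed.

(** Chaining: if [g = h * k] and [k] is near [l.1 * l.2^-1], then [b^-1 g b'] is near the product of
    [b^-1 h l.1] and [l.2^-1 b']. The induction hypothesis supplies words for the first factor and
    [M] bounds those for the second, so each of the [theta] pairs [l] contributes. One more factor
    thus multiplies the count by [M * theta] and adds [r + s] to the radius. *)
Lemma reps_power (J Y : finType) (w : J -> G) (py : Y -> G) (B : {set Y})
    (r s M theta : R) (S : G -> Prop) (n : nat) (g : G) (b b' : Y) :
  0 <= r -> 0 <= s -> 0 <= M -> 0 <= theta ->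
  (forall y y', close ((r + (r + s) *+ n) *+ 2) (py y) (py y') -> y = y') ->
  (forall b b', b \in B -> b' \in B -> M <= #|reps w r ((py b)^-1 * py b')%g|%:R) ->
  (forall g, S g -> theta <= #|[set l : Y * Y |
     [&& l.1 \in B, l.2 \in B & close s (py l.1 * (py l.2)^-1)%g g]]%SET|%:R) ->
  power S n g -> b \in B -> b' \in B ->
  M * (M * theta) ^+ n <=
    #|reps (wordv w (n := n)) (r + (r + s) *+ n) ((py b)^-1 * g * py b')%g|%:R.
Proof.
move=> r0 s0 M0 th0 + geM geS.
elim: n g b b' => [g b b' sep -> bB b'B|n IH g b b' sep [h [k [nh Sk ->]]] bB b'B] /=.
  by rewrite mulr1 mulr0n addr0 mulg1 geM.
have sepn y y' : close ((r + (r + s) *+ n) *+ 2) (py y) (py y') -> y = y'.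
  move=> yy'; apply: sep; apply: close_le yy'; rewrite lerMn2r /= lerD2l ler_wpMn2l //.
  exact: addr_ge0.
pose A := [set l : Y * Y | [&& l.1 \in B, l.2 \in B & close s (py l.1 * (py l.2)^-1)%g k]]%SET.
have := @reps_wmul (word (J := J) n) J (Y * Y)%type (wordv w (n := n)) w
  (fun l => py l.1) (fun l => py l.2) A (r + (r + s) *+ n) r s
  (M * (M * theta) ^+ n) M ((py b)^-1 * h)%g (py b') k.
rewrite mulgA (_ : r + (r + s) *+ n + r + s = r + (r + s) *+ n.+1); last first.
  by rewrite mulrSr !addrA.
move=> H; apply: le_trans (H _ _ _ _ _ _) => //.
- rewrite (_ : M * _ = theta * (M * (M * theta) ^+ n * M)); last by rewrite exprS; ring.
  by rewrite ler_wpM2r ?geS // !mulr_ge0 // exprn_ge0 // mulr_ge0.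
- by rewrite mulr_ge0 ?exprn_ge0 ?mulr_ge0.
(* Separation recovers [l1]. Both quotients are then within [s] of [k] and share [l1], which brings
   [l2] and [l2'] within [s + s]. *)
- move=> [l1 l2] [l1' l2']; rewrite !inE /= => /and3P[_ _ c1] /and3P[_ _ c2].
  rewrite -mulr2n => /sepn ll'; rewrite -ll' in c2 *; congr pair; apply: sep.
  have : close (s + s) (py l1 * (py l2)^-1)%g (py l1 * (py l2')^-1)%g.
    by apply: close_trans c1 _; rewrite close_sym.
  rewrite close_mul2l close_inv; apply: close_le.
  rewrite -mulr2n lerMn2r /= mulrSr addrA.
  by rewrite ler_wpDl ?lerDr ?addr_ge0 ?mulrn_wge0 ?addr_ge0.
- by move=> l; rewrite inE => /and3P[].
- by move=> l; rewrite inE => /and3P[l1B l2B _]; exact: IH.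
- by move=> l; rewrite inE => /and3P[l1B l2B _]; exact: geM.
Qed.

(** The infimum over a nonempty finite set is attained, and the empty set is excluded because its
    distance is [+oo]. *)
Lemma dist_to_close (Z : {fset G}) (r : R) (g : G) :
  (dist_to d g [set` Z]%classic <= r%:E)%E -> exists2 z, z \in Z & close r g z.
Proof.
have [->|[z0 z0Z]] := fset_0Vmem Z.
  rewrite /dist_to (_ : [set` _] = set0)%classic ?image_set0 ?ereal_inf0 //.
  by apply/seteqP; split.
move=> h.
have [z _ zmin] := Order.TotalTheory.arg_minP
  (i0 := [` z0Z]%fset) (P := xpredT) (fun z : Z => d g (val z)) isT.
exists (val z); first exact: valP.
apply: le_trans h; apply: le_ereal_inf_tmp => _ [u /= uZ <-].
exact: (zmin [` uZ]%fset).
Qed.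

Lemma close_nbhd r g u (U : set G) : U u -> close r g u -> nbhd d r U g.
Proof. by move=> Uu; apply: le_trans; apply: ereal_inf_lbound; exists u. Qed.

(* A maximal set of points of T, no two of which are related, is an r-net. *)
Lemma maximal_net (T : set G) (r : rel G) (m : R) :
  (forall g, T g -> r g g) -> (forall g h, r g h = r h g) ->
  (forall K : {fset G}, (forall k, k \in K -> T k) ->
     (forall k l, k \in K -> l \in K -> r k l -> k = l) -> #|` K|%:R <= m) ->
  exists K : {fset G}, [/\ forall k, k \in K -> T k, #|` K|%:R <= m
     & forall g, T g -> exists2 k, k \in K & r g k].
Proof.
move=> rxx rC bound.
pose ok (K : {fset G}) := (forall k, k \in K -> T k) /\
   (forall k l, k \in K -> l \in K -> r k l -> k = l).
pose P n := `[< exists K, ok K /\ #|` K| = n >].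
have ok0 : ok fset0 by split => [k|k l]; rewrite inE.
have exP : exists n, P n by exists 0%N; apply/asboolP; exists fset0; rewrite cardfs0.
have leP n : P n -> (n <= Num.bound m)%N.
  move=> /asboolP[K [[K1 K2] <-]]; rewrite -(ler_nat R).
  have Km := bound K K1 K2; apply: (le_trans Km); apply/ltW/archi_boundP.
  exact: le_trans Km.
case: (ex_maxnP exP leP) => n /asboolP[K [[K1 K2] <-]] maxK.
exists K; split=> [//||g Tg]; first exact: bound.
apply: contrapT => nog.
have gK : g \notin K by apply/negP => gK; apply: nog; exists g => //; exact: rxx.
suff : (#|` g |` K| <= #|` K|)%N%fset by rewrite cardfsU1 gK add1n ltnn.
apply: maxK; apply/asboolP; exists (g |` K)%fset; split => //; split.
  by move=> k /fset1UP[-> //|]; exact: K1.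
move=> k l /fset1UP[->|kK] /fset1UP[->|lK] //; last exact: K2.
  by move=> gl; case: nog; exists l.
by rewrite rC => gk; case: nog; exists k.
Qed.


(** * Popular quotients *)

Section Core.
Context {X Y Z : finType} (px : X -> G) (py : Y -> G) (pz : Z -> G) (z0 : Z).
Variables (delta eps : R).
Hypothesis sepX : forall r x x', r < 1 -> close r (px x) (px x') -> x = x'.
Hypothesis sepY : forall r y y', r < 1 -> close r (py y) (py y') -> y = y'.
Hypotheses (delta_gt0 : 0 < delta) (delta_lt : delta < 1 / 100).
Hypotheses (eps_gt0 : 0 < eps) (eps_lt : eps < 1 / 1000).
Hypotheses (X_gt0 : (0 < #|X|)%N) (Y_gt0 : (0 < #|Y|)%N).

Let E x y := [exists z, close eps (px x * py y)%g (pz z)].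
Let N : R := #|Z|%:R.

Hypothesis E_dense : delta * #|X|%:R * #|Y|%:R <= #|[set p | E p.1 p.2]%SET|%:R.
Hypothesis Z_small : N <= delta^-1 * Num.sqrt #|X|%:R * Num.sqrt #|Y|%:R.

(** The value [z0] is a default, returned only where [E] fails. *)
Definition label x y : Z := odflt z0 [pick z | close eps (px x * py y)%g (pz z)].

Lemma labelP x y : E x y -> close eps (px x * py y)%g (pz (label x y)).
Proof.
by move=> /existsP[z hz]; rewrite /label; case: pickP => [z' //|/(_ z)]; rewrite hz.
Qed.

Lemma label_eq x y x' y' : E x y -> E x' y' -> label x y = label x' y' ->
  close (2 * eps) (px x * py y)%g (px x' * py y')%g.
Proof.
move=> /labelP h /labelP h' e; rewrite mulr_natl mulr2n; apply: close_trans h _.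
by rewrite e close_sym.
Qed.

Lemma eps_small (k : nat) : (k <= 1000)%N -> k%:R * eps < 1.
Proof.
rewrite -(ler_nat R) => k_le; have e0 := eps_gt0; have e1 := eps_lt.
by apply: (@le_lt_trans _ _ (1000 * eps)); [rewrite ler_pM2r|lra].
Qed.

(** The labelling is a proper edge colouring: edges with a common endpoint and a common label have
    their other endpoints within [2 * eps], hence equal by separation. *)
Lemma label_injl x x' y : E x y -> E x' y -> label x y = label x' y -> x = x'.
Proof.
by move=> h h' /(label_eq h h'); rewrite close_mul2r => c; apply: sepX c; exact: eps_small.
Qed.

Lemma label_injr x y y' : E x y -> E x y' -> label x y = label x y' -> y = y'.
Proof.
by move=> h h' /(label_eq h h'); rewrite close_mul2l => c; apply: sepY c; exact: eps_small.
Qed.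

Lemma N_gt0 : 0 < N.
Proof. by rewrite ltr0n; apply/card_gt0P; exists z0. Qed.

(** Edges at a fixed [y] have distinct labels, so each [y] has degree at most [N]; summing over [y]
    bounds the number of edges by [N * #|Y|]. *)
Lemma deltaX_le : delta * #|X|%:R <= N.
Proof.
have y0 : 0 < #|Y|%:R :> R by rewrite ltr0n.
rewrite -(ler_pM2r y0); apply: (le_trans E_dense).
rewrite card_pairs_swap natr_sum mulr_natr -sumr_const.
apply: ler_sum => y _; rewrite ler_nat -(@card_in_imset _ _ (label^~ y)) ?max_card //.
by move=> x x'; rewrite !inE; exact: label_injl.
Qed.

Lemma deltaY_le : delta * #|Y|%:R <= N.
Proof.
have x0 : 0 < #|X|%:R :> R by rewrite ltr0n.
rewrite -(ler_pM2l x0) mulrCA mulrA; apply: (le_trans E_dense).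
rewrite card_pairs natr_sum mulr_natl -sumr_const.
apply: ler_sum => x _; rewrite ler_nat -(@card_in_imset _ _ (label x)) ?max_card //.
by move=> y y'; rewrite !inE; exact: label_injr.
Qed.

Lemma delta2_N2_le : (delta * N) ^+ 2 <= #|X|%:R * #|Y|%:R.
Proof.
have : (delta * N) ^+ 2 <= (Num.sqrt #|X|%:R * Num.sqrt #|Y|%:R) ^+ 2.
  apply: lerXn2r; rewrite ?nnegrE ?mulr_ge0 ?sqrtr_ge0 ?ler0n //; first exact: ltW.
  by rewrite -ler_pdivlMl // mulrA.
by rewrite [X in _ <= X]exprMn !sqr_sqrtr ?ler0n.
Qed.

(** The bound on [N] gives [(delta * N) ^+ 2 <= #|X| * #|Y|], where [#|Y|] is at most
    [N / delta]. *)
Lemma X_ge : delta ^+ 3 * N <= #|X|%:R.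
Proof.
rewrite -(ler_pM2r N_gt0).
have d0 := delta_gt0; have N0 := N_gt0; have := ler_wpM2l (ltW delta_gt0) delta2_N2_le.
have := ler_wpM2l (ler0n R #|X|) deltaY_le; nra.
Qed.

Lemma Y_ge : delta ^+ 3 * N <= #|Y|%:R.
Proof.
rewrite -(ler_pM2r N_gt0).
have d0 := delta_gt0; have N0 := N_gt0; have := ler_wpM2l (ltW delta_gt0) delta2_N2_le.
have := ler_wpM2l (ler0n R #|Y|) deltaX_le; nra.
Qed.

(** * Words in the quotients of labels *)

Definition zdiv (p : Z * Z) : G := ((pz p.1)^-1 * pz p.2)%g.
Definition zdiv2 : (Z * Z) * (Z * Z) -> G := wmul zdiv zdiv.

(** A common neighbour [x] writes [y^-1 y'] as [(x y)^-1 (x y')], a quotient of two points near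
    labels; the first label already determines [x]. *)
Lemma codegree_reps y y' :
  (codegree E y y' <= #|reps zdiv (2 * eps) ((py y)^-1 * py y')%g|)%N.
Proof.
rewrite /codegree -(@card_in_imset _ _ (fun x => (label x y, label x y'))); last first.
  by move=> x x'; rewrite !inE => /andP[h _] /andP[h' _] [e _]; exact: label_injl e.
apply/subset_leq_card/fintype.subsetP => _ /imsetP[x + ->].
rewrite !inE => /andP[/labelP h /labelP h'].
rewrite /zdiv /= (_ : _ * py y' = (px x * py y)^-1 * (px x * py y'))%g; last first.
  by rewrite invgM -mulgA mulKg.
rewrite mulr_natl mulr2n; apply: close_mul; last by rewrite close_sym.
by rewrite close_inv close_sym.
Qed.

(** Factor [b^-1 b'] as [(b^-1 y) (y^-1 b')] over the [y] in [V] of large codegree with both ends.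
    There are [delta ^+ 6 * N] such [y], and [delta ^+ 7 * N] words for each factor, whence the
    exponents 20 and 3. Numerical constants are absorbed into powers of [delta], as
    [delta < 1 / 100]. *)
Lemma popular_products : exists B : {set Y},
  [/\ delta ^+ 6 * N <= #|B|%:R,
      forall y, y \in B -> delta ^+ 5 * N <= (degree E y)%:R
    & forall b b', b \in B -> b' \in B ->
        delta ^+ 20 * N ^+ 3 <= #|reps zdiv2 (4 * eps) ((py b)^-1 * py b')%g|%:R].
Proof.
have d0 := delta_gt0; have d1 := delta_lt; have N0 := N_gt0.
have Xge := X_ge; have Yge := Y_ge.
have [V [B [hV hB hdeg hgood]]] := dependent_choice X_gt0 Y_gt0 delta_gt0 E_dense.
have V_ge : delta ^+ 5 * N <= #|V|%:R.
  apply: le_trans hV; rewrite (_ : _ * N = delta ^+ 2 * (delta ^+ 3 * N)); last by ring.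
  by rewrite ler_pM ?mulr_ge0 ?exprn_ge0 ?(ltW d0) ?(ltW N0) //; nra.
have V2_ge : delta ^+ 6 * N <= #|V|%:R / 2.
  have t0 : 0 < delta ^+ 5 * N by rewrite mulr_gt0 ?exprn_gt0.
  rewrite (_ : delta ^+ 6 * N = delta * (delta ^+ 5 * N)); last by ring.
  by move: (delta ^+ 5 * N) t0 V_ge => t t0 V_ge; nra.
exists B; split.
- exact: le_trans hB.
- move=> y /hdeg; apply: le_trans.
  rewrite (_ : _ * N = delta ^+ 2 * (delta ^+ 3 * N)); last by ring.
  by rewrite ler_pM ?mulr_ge0 ?exprn_ge0 ?(ltW d0) ?(ltW N0) //; nra.
move=> b b' bB b'B.
have c_ge : delta ^+ 7 * N <= delta ^+ 2 / 128 * #|X|%:R.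
  rewrite (_ : _ * N = delta ^+ 4 * (delta ^+ 3 * N)); last by ring.
  rewrite ler_pM ?mulr_ge0 ?exprn_ge0 ?(ltW d0) ?(ltW N0) //.
  rewrite (_ : delta ^+ 4 = delta ^+ 2 * delta ^+ 2); last by ring.
  by rewrite ler_wpM2l ?exprn_ge0 ?(ltW d0) // expr2; nra.
pose A := [set y in V |
  (delta ^+ 2 / 128 * #|X|%:R <= (codegree E b y)%:R) &&
  (delta ^+ 2 / 128 * #|X|%:R <= (codegree E y b')%:R)]%SET.
have := @reps_wmul _ _ Y zdiv zdiv py py A (2 * eps) (2 * eps) 0
  (delta ^+ 7 * N) (delta ^+ 7 * N) (py b)^-1%g (py b') 1%g.
rewrite mulg1 addr0 (_ : 2 * eps + 2 * eps = 4 * eps); last by ring.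
move=> H; apply: le_trans (H _ _ _ _ _ _).
- rewrite (_ : _ * N ^+ 3 = delta ^+ 6 * N * (delta ^+ 7 * N * (delta ^+ 7 * N))); last by ring.
  rewrite ler_wpM2r ?mulr_ge0 ?exprn_ge0 ?(ltW delta_gt0) ?(ltW N0) //.
  exact: le_trans (hgood _ _ bB b'B).
- by rewrite mulr_ge0 ?exprn_ge0 // ltW.
- by rewrite mulr_ge0 ?exprn_ge0 // ltW.
- by move=> l l' _ _; move=> c; apply: sepY c; exact: eps_small.
- by move=> l _; rewrite mulgV closexx.
- move=> l; rewrite inE => /and3P[_ h _]; apply: (le_trans c_ge); apply: (le_trans h).
  by rewrite ler_nat codegree_reps.
- move=> l; rewrite inE => /and3P[_ _ h]; apply: (le_trans c_ge); apply: (le_trans h).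
  by rewrite ler_nat codegree_reps.
Qed.

Lemma delta_exp (m n : nat) : (m <= n)%N -> delta ^+ n <= delta ^+ m.
Proof.
have d0 := delta_gt0; have d1 := delta_lt.
by move=> mn; apply: ler_wiXn2l mn; lra.
Qed.

Lemma delta_exp_ge0 n : 0 <= delta ^+ n.
Proof. exact/exprn_ge0/ltW. Qed.

Lemma delta_expN_ge0 m n : 0 <= delta ^+ m * N ^+ n.
Proof. by apply: mulr_ge0 (delta_exp_ge0 m) (exprn_ge0 n _); exact: ler0n. Qed.

(** * The set of popular quotients and packing in its powers *)

Section PopularQuotients.
Variable B : {set Y}.
Hypothesis B_ge : delta ^+ 6 * N <= #|B|%:R.
Hypothesis B_degree : forall y, y \in B -> delta ^+ 5 * N <= (degree E y)%:R.
Hypothesis B_words : forall b b', b \in B -> b' \in B ->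
  delta ^+ 20 * N ^+ 3 <= #|reps zdiv2 (4 * eps) ((py b)^-1 * py b')%g|%:R.

Definition quotients (g : G) : {set Y * Y} :=
  [set l | [&& l.1 \in B, l.2 \in B & close (2 * eps) (py l.1 * (py l.2)^-1)%g g]]%SET.

(** The threshold is the one that the collision count in [popular_translate] can deliver. *)
Definition popular (g : G) : Prop := delta ^+ 25 * N <= #|quotients g|%:R.

Lemma popular1 : popular 1%g.
Proof.
have N0 := N_gt0; apply: (@le_trans _ _ #|B|%:R).
  by apply: le_trans B_ge; rewrite ler_wpM2r ?delta_exp ?(ltW N0).
rewrite ler_nat -(@card_in_imset _ _ (fun y => (y, y))) => [|y y' _ _ []//].
apply/subset_leq_card/fintype.subsetP => _ /imsetP[y yB ->].
by rewrite inE /= yB mulgV closexx // mulr_ge0 // ltW.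
Qed.

Lemma popularV g : popular g -> popular g^-1%g.
Proof.
move=> /le_trans; apply; rewrite ler_nat.
rewrite -(@card_in_imset _ _ (fun l => (l.2, l.1))) => [|[a b] [a' b'] _ _ [-> ->]//].
apply/subset_leq_card/fintype.subsetP => _ /imsetP[[a b] + ->].
by rewrite !inE /= => /and3P[-> -> c]; rewrite -close_inv invgM !invgK.
Qed.

(** If [u b] and [x b'] have the same label, then [u^-1 x] is near [b b'^-1]. Collisions of labels
    among the edges into [B] number at least [delta ^+ 22 * N ^+ 3]; a popular first endpoint [u]
    keeps [delta ^+ 23 * N ^+ 2] of them, and [A] collects the [x] that occur in many of these. *)
Lemma popular_translate : exists (u : X) (A : {set X}),
  delta ^+ 25 * N <= #|A|%:R /\ forall x, x \in A ->
    popular ((px u)^-1 * px x)%g /\ delta ^+ 25 * N <= #|[set y in B | E x y]%SET|%:R.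
Proof.
have d0 := delta_gt0; have d1 := delta_lt; have N0 := N_gt0.
pose F := [set p : X * Y | (p.2 \in B) && E p.1 p.2]%SET.
pose lab (p : X * Y) := label p.1 p.2.
pose W := [set q : (X * Y) * (X * Y) | [&& q.1 \in F, q.2 \in F & lab q.1 == lab q.2]]%SET.
have F_ge : delta ^+ 11 * N ^+ 2 <= #|F|%:R.
  rewrite (card_pairs_swap (fun x y => (y \in B) && E x y)) natr_sum.
  apply: (@le_trans _ _ (\sum_(y in B) (delta ^+ 5 * N))).
    rewrite sumr_const -mulr_natl (_ : _ * N ^+ 2 = delta ^+ 6 * N * (delta ^+ 5 * N)).
      by rewrite ler_wpM2r // (delta_expN_ge0 _ 1).
    by ring.
  rewrite big_mkcond; apply: ler_sum => y _; case: ifP => [yB|_]; last exact: ler0n.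
  by rewrite /=; apply: (le_trans (B_degree yB)).
have W_ge : delta ^+ 22 * N ^+ 3 <= #|W|%:R.
  rewrite -(ler_pM2l N0); apply: le_trans (card_collisions F lab).
  rewrite (_ : N * _ = (delta ^+ 11 * N ^+ 2) ^+ 2); last by ring.
  by apply: lerXn2r; rewrite ?nnegrE ?delta_expN_ge0.
have [||u] := @popular_fibre R _ X W (fun u q => q.1.1 == u) => //.
  by move=> q _; exists q.1.1.
set Wu := [set q in W | _]%SET => hu.
have Wu_ge : delta ^+ 23 * N ^+ 2 <= #|Wu|%:R.
  have h1 := ler_wpM2r (ler0n R #|Wu|) deltaX_le.
  have h2 := ler_wpM2l (ltW d0) hu; have h3 := ler_wpM2l (ltW d0) W_ge.
  rewrite -(ler_pM2l N0) (_ : N * _ = delta * (delta ^+ 22 * N ^+ 3)); last by ring.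
  by lra.
pose Q x := [set l : Y * Y |
  [&& l.1 \in B, l.2 \in B, E u l.1, E x l.2 & label u l.1 == label x l.2]]%SET.
have WuQ : (#|Wu| <= \sum_x #|Q x|)%N.
  have -> : (\sum_x #|Q x| = \sum_x #|[set l | l \in Q x]%SET|)%N.
    by apply: eq_bigr => x _; apply: eq_card => l; rewrite inE.
  rewrite -(card_pairs (fun x l => l \in Q x)).
  rewrite -(@card_in_imset _ _ (fun q => (q.2.1, (q.1.2, q.2.2)))); last first.
    move=> [[a b] [a' b']] [[e f] [e' f']]; rewrite !inE /=.
    by move=> /andP[_ /eqP->] /andP[_ /eqP->] [-> -> ->].
  apply/subset_leq_card/fintype.subsetP => _ /imsetP[[[a b] [a' b']] + ->].
  rewrite !inE /= => /andP[/and3P[/andP[-> Eab] /andP[-> ->] e] /eqP au].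
  by rewrite -au Eab.
(* The component [l.2] fixes the common label, which at [u] fixes [l.1]. So a large [Q x] gives [x]
   many neighbours in [B] as well. *)
have QE x : (#|Q x| <= #|[set y in B | E x y]%SET|)%N.
  rewrite -(@card_in_imset _ _ snd); last first.
    move=> [a b] [a' b']; rewrite !inE /=.
    move=> /and5P[_ _ Ea _ /eqP e] /and5P[_ _ Ea' _ /eqP e'] bb'.
    by rewrite -bb' in e' *; congr pair; apply: (label_injr Ea Ea'); rewrite e e'.
  apply/subset_leq_card/fintype.subsetP => _ /imsetP[[a b] + ->].
  by rewrite !inE /= => /and5P[_ -> _ -> _].
exists u, [set x | delta ^+ 25 * N <= #|Q x|%:R]%SET.
set A := [set x | _]%SET; split; last first.
  move=> x; rewrite inE => hx; split; last by apply: (le_trans hx); rewrite ler_nat.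
  apply: (le_trans hx); rewrite ler_nat; apply/subset_leq_card/fintype.subsetP => -[a b].
  rewrite !inE /= => /and5P[-> -> Eua Exb /eqP e] /=.
  by rewrite -close_divr mulgA close_divl invgK label_eq.
(* Each [x] in [A] contributes at most [#|Y|], every other [x] less than the threshold; the latter
   total at most [delta ^+ 24 * N ^+ 2], a small part of the whole. *)
have : delta ^+ 23 * N ^+ 2 <= #|A|%:R * #|Y|%:R + delta ^+ 25 * N * #|X|%:R.
  apply: (le_trans Wu_ge); apply: (@le_trans _ _ (\sum_x #|Q x|%:R)).
    by rewrite -natr_sum ler_nat.
  have -> : #|A|%:R * #|Y|%:R = \sum_x (if x \in A then #|Y|%:R else 0) :> R.
    by rewrite -big_mkcond sumr_const mulr_natl.
  have -> : delta ^+ 25 * N * #|X|%:R = \sum_(x : X) (delta ^+ 25 * N).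
    by rewrite sumr_const mulr_natr.
  rewrite -big_split /=; apply: ler_sum => x _.
  case: ifP; rewrite inE => hx.
    rewrite ler_wpDr ?(delta_expN_ge0 _ 1) // ler_nat.
    exact: leq_trans (QE x) (max_card _).
  by rewrite add0r ltW // ltNge hx.
have := ler_wpM2l (ler0n R #|A|) deltaY_le.
have := ler_wpM2l (mulr_ge0 (delta_exp_ge0 25) (ltW N0)) deltaX_le.
move=> h1 h2 /(ler_wpM2l (ltW d0)) h3.
rewrite -(ler_pM2r N0).
have : delta ^+ 25 * N * N * 2 <= delta ^+ 24 * N * N.
  rewrite (_ : _ * 2 = delta ^+ 24 * (delta * 2) * N * N); last by ring.
  rewrite !ler_wpM2r ?(ltW N0) // -[leRHS]mulr1 ler_wpM2l ?delta_exp_ge0 //; lra.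
move: h1 h2 h3.
rewrite (_ : delta * (delta ^+ 23 * N ^+ 2) = delta ^+ 24 * N * N); last by ring.
by lra.
Qed.

Let S := power popular.

Lemma power2_quotient a b : popular a -> popular b -> S 2 (a^-1 * b)%g.
Proof. by move=> /popularV/power1 pa /power1 pb; exact: (power_mul pa pb). Qed.

(** For [b] in [B] and [g] in the fifth power, chaining gives [b^-1 g b] at least
    [delta ^+ 245 * N ^+ 23] words out of [N ^+ 24], where [245 = 20 + 5 * (20 + 25)]. The radius is
    [34 * eps], so points that are not [70 * eps] close share no word. Five factors accommodate a
    fourth power times one popular element. *)
Lemma power5_packing (L : finType) (c : L -> G) : (forall l, S 5 (c l)) ->
  (forall l l', close (70 * eps) (c l) (c l') -> l = l') ->
  #|L|%:R * delta ^+ 245 <= N.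
Proof.
move=> Sc sepc; have d0 := delta_gt0; have N0 := N_gt0; have e0 := eps_gt0.
have [b bB] : exists b, b \in B.
  apply/card_gt0P; rewrite -(ltr_nat R); apply: lt_le_trans B_ge.
  by rewrite mulr_gt0 // exprn_gt0.
have r34 : 4 * eps + (4 * eps + 2 * eps) *+ 5 = 34 * eps by ring.
have H := @packing_bound _ (wordv zdiv2 (n := 5)) L
  (fun l => ((py b)^-1 * c l * py b)%g) (34 * eps)
  (delta ^+ 20 * N ^+ 3 * (delta ^+ 20 * N ^+ 3 * (delta ^+ 25 * N)) ^+ 5).
have : #|L|%:R * (delta ^+ 245 * N ^+ 23) <= N ^+ 24.
  rewrite (_ : delta ^+ 245 * _ =
    delta ^+ 20 * N ^+ 3 * (delta ^+ 20 * N ^+ 3 * (delta ^+ 25 * N)) ^+ 5); last first.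
    by ring.
  apply: le_trans (H _ _) _.
  - move=> l l'; rewrite close_mul2r close_mul2l => cl; apply: sepc.
    by apply: close_le cl; lra.
  - move=> l; rewrite -r34; apply: (@reps_power _ _ _ _ B _ _ _ _ popular) => //.
    + by rewrite mulr_ge0 // ltW.
    + by rewrite mulr_ge0 // ltW.
    + by rewrite delta_expN_ge0.
    + by rewrite (delta_expN_ge0 _ 1).
    + move=> y y'; rewrite r34 -mulrnAl -mulrnA => cl.
      by apply: sepY cl; exact: eps_small.
    + exact: Sc.
  rewrite card_word !card_prod /N -natrX ler_nat.
  by rewrite !mulnn -!expnM.
rewrite exprS [in leLHS]mulrA ler_pM2r ?exprn_gt0 //.
Qed.


(** * Ruzsa covering, nets and the right translate *)

Section Structure.
Variables (u : X) (A : {set X}).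
Hypothesis A_ge : delta ^+ 25 * N <= #|A|%:R.
Hypothesis A_popular : forall x, x \in A -> popular ((px u)^-1 * px x)%g.
Hypothesis A_degree : forall x, x \in A ->
  delta ^+ 25 * N <= #|[set y in B | E x y]%SET|%:R.

(** Ruzsa covering with the translates of [u^-1 A]: [r g k] says that the translates by [g] and [k]
    come close somewhere. For pairwise unrelated [k] the products [k * s x] are separated in the
    fifth power, so packing bounds their number, with [270 = 245 + 25]. If [g] is related to [k],
    then [g] is near [k * s x' * (s x)^-1]. *)
Lemma power4_covering : exists K : {fset G}, #|` K|%:R * delta ^+ 270 <= 1 /\
  forall g, S 4 g -> exists2 k, k \in K & exists2 h, S 2 h & close (70 * eps) g (k * h)%g.
Proof.
have d0 := delta_gt0; have N0 := N_gt0; have e0 := eps_gt0.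
have d270 : 0 < delta ^+ 270 by rewrite exprn_gt0.
pose s x := ((px u)^-1 * px x)%g.
pose r (g k : G) := [exists x, exists x', [&& x \in A, x' \in A &
  close (70 * eps) (g * s x)%g (k * s x')%g]].
have rP g k : reflect (exists x x', [/\ x \in A, x' \in A &
    close (70 * eps) (g * s x)%g (k * s x')%g]) (r g k).
  by apply: (iffP 'exists_existsP) => -[x [x' /and3P h]]; exists x, x'.
have [a aA] : exists a, a \in A.
  apply/card_gt0P; rewrite -(ltr_nat R); apply: lt_le_trans A_ge.
  by rewrite mulr_gt0 // exprn_gt0.
have [g _|g k|K KS Ksep|K [KS Kle Knet]] := @maximal_net (S 4) r (delta ^+ 270)^-1.
- by apply/rP; exists a, a; split => //; rewrite closexx // mulr_ge0 // ltW.
- by apply/rP/rP => -[x [x' [xA x'A c]]]; exists x', x; rewrite close_sym.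
- have := @power5_packing (K * {x | x \in A})%type (fun l => val l.1 * s (val l.2))%g.
  rewrite card_prod -cardfE card_sig => H.
  have {H} : (#|` K| * #|A|)%:R * delta ^+ 245 <= N.
    apply: H => [[k [x xA]]|[k [x xA]] [k' [x' x'A]]] /=.
      by exists (val k), (s x); split => //; [exact/KS/valP | exact: A_popular].
    move=> c; have kk' : k = k'.
      apply/val_inj/Ksep; [exact: valP | exact: valP |].
      by apply/rP; exists x, x'.
    rewrite -{k'}kk' in c *; congr pair; apply: val_inj => /=.
    by move: c; rewrite !close_mul2l => c; apply: sepX c; exact: eps_small.
  rewrite natrM => h; rewrite -div1r ler_pdivlMr // -(ler_pM2r N0) mul1r.
  apply: le_trans h.
  rewrite (_ : _ * N = #|` K|%:R * (delta ^+ 25 * N) * delta ^+ 245); last by ring.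
  by rewrite ler_wpM2r ?delta_exp_ge0 // ler_wpM2l.
exists K; split; first by rewrite -ler_pdivlMr // div1r.
move=> g /Knet[k kK /rP[x [x' [xA x'A c]]]]; exists k => //.
exists (s x' * (s x)^-1)%g; last by rewrite mulgA -close_divl.
have := power2_quotient (popularV (A_popular x'A)) (popularV (A_popular xA)).
by rewrite invgK.
Qed.

(** A maximal separated subset is a net, and packing applies because [1] is popular and the square
    lies in the fifth power. *)
Lemma power2_net : exists P : {fset G}, #|` P|%:R * delta ^+ 245 <= N /\
  forall g, S 2 g -> exists2 p, p \in P & close (70 * eps) g p.
Proof.
have d0 := delta_gt0; have e0 := eps_gt0.
have d245 : 0 < delta ^+ 245 by rewrite exprn_gt0.
have [g _|g k|P PS Psep|P [PS Ple Pnet]] :=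
  @maximal_net (S 2) (close (70 * eps)) (N / delta ^+ 245).
- by rewrite closexx // mulr_ge0 // ltW.
- exact: close_sym.
- rewrite ler_pdivlMr // cardfE; apply: (@power5_packing _ val) => [p|p q c].
    by apply: (power_le popular1 (m := 2)) => //; exact/PS/valP.
  by apply/val_inj/Psep => //; exact: valP.
by exists P; split => //; rewrite -ler_pdivlMr.
Qed.

(** If [x y] and [x' v] have the same label, then [y] is near [x^-1 x' v], and [x^-1 x'] is a
    quotient of the popular elements [u^-1 x] and [u^-1 x']. *)
Lemma right_translate : exists (v : Y) (D : {set Y}),
  (forall y, y \in D -> exists2 h, S 2 h & close (2 * eps) (py y) (h * py v)%g) /\
  delta ^+ 101 * N ^+ 2 <= #|[set p | [&& p.1 \in A, p.2 \in D & E p.1 p.2]]%SET|%:R.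
Proof.
have d0 := delta_gt0; have N0 := N_gt0.
pose F := [set p : X * Y | (p.1 \in A) && ((p.2 \in B) && E p.1 p.2)]%SET.
pose lab (p : X * Y) := label p.1 p.2.
pose W := [set q : (X * Y) * (X * Y) | [&& q.1 \in F, q.2 \in F & lab q.1 == lab q.2]]%SET.
have F_ge : delta ^+ 50 * N ^+ 2 <= #|F|%:R.
  rewrite (card_pairs (fun x y => (x \in A) && ((y \in B) && E x y))) natr_sum.
  apply: (@le_trans _ _ (\sum_(x in A) (delta ^+ 25 * N))).
    rewrite sumr_const -mulr_natl (_ : _ * N ^+ 2 = delta ^+ 25 * N * (delta ^+ 25 * N)).
      by rewrite ler_wpM2r // (delta_expN_ge0 _ 1).
    by ring.
  rewrite big_mkcond; apply: ler_sum => x _; case: ifP => [xA|_]; last exact: ler0n.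
  exact: A_degree.
have W_ge : delta ^+ 100 * N ^+ 3 <= #|W|%:R.
  rewrite -(ler_pM2l N0); apply: le_trans (card_collisions F lab).
  rewrite (_ : N * _ = (delta ^+ 50 * N ^+ 2) ^+ 2); last by ring.
  by apply: lerXn2r; rewrite ?nnegrE ?delta_expN_ge0.
have [||v] := @popular_fibre R _ Y W (fun v q => q.2.2 == v) => //.
  by move=> q _; exists q.2.2.
set Wv := [set q in W | _]%SET => hv.
have Wv_ge : delta ^+ 101 * N ^+ 2 <= #|Wv|%:R.
  have h1 := ler_wpM2r (ler0n R #|Wv|) deltaY_le.
  have h2 := ler_wpM2l (ltW d0) hv; have h3 := ler_wpM2l (ltW d0) W_ge.
  rewrite -(ler_pM2l N0) (_ : N * _ = delta * (delta ^+ 100 * N ^+ 3)); last by ring.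
  by lra.
exists v, [set y | [exists x, exists x', [&& x \in A, x' \in A, E x y, E x' v &
  label x y == label x' v]]]%SET; split.
  move=> y; rewrite inE => /'exists_existsP[x [x' /and5P[xA x'A Exy Exv /eqP e]]].
  exists (((px u)^-1 * px x)^-1 * ((px u)^-1 * px x'))%g.
    by apply: power2_quotient; exact: A_popular.
  rewrite invgM invgK -[(_ * px u * _)%g]mulgA mulVKg -mulgA -close_divr.
  exact: label_eq.
(* A collision is determined by its first edge: the second ends at [v] and has the same label. Hence
   the collisions at [v] count edges between [A] and [D]. *)
apply: (le_trans Wv_ge); rewrite ler_nat -(@card_in_imset _ _ fst); last first.
  move=> [p [a b]] [p' [a' b']]; rewrite !inE /=.
  move=> /andP[/and3P[_ /and3P[_ _ Eab] /eqP e] /eqP bv].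
  move=> /andP[/and3P[_ /and3P[_ _ Eab'] /eqP e'] /eqP bv'] pp'.
  rewrite -{p'}pp' bv bv' in e e' Eab Eab' *; congr (_, (_, _)).
  by apply: (label_injl Eab Eab'); rewrite -[LHS]e -[RHS]e'.
apply/subset_leq_card/fintype.subsetP => _ /imsetP[[[a b] [a' b']] + ->]; rewrite !inE /=.
move=> /andP[/and3P[/and3P[aA _ Eab] /and3P[a'A _ Eab'] e] /eqP bv].
rewrite aA Eab /= andbT; apply/'exists_existsP; exists a, a'.
by rewrite aA a'A Eab -bv Eab' e.
Qed.

End Structure.

End PopularQuotients.

(** * Assembly of the structure over finite types *)

Theorem finite_structure :
  exists (A : {set X}) (D : {set Y}) (C : {set Z}) (H : set G) (u v w : G)
         (K P : {fset G}),
    [/\ [/\ delta ^+ 25 * N <= #|A|%:R, delta ^+ 102 * N <= #|D|%:R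
          & delta ^+ 372 * N <= #|C|%:R],
        #|` K|%:R * delta ^+ 270 <= 1 /\
          (forall g h, H g -> H h ->
             exists2 k, k \in K & exists2 f, H f & close (70 * eps) (g * h)%g (k * f)%g),
        #|` P|%:R * delta ^+ 245 <= N /\
          (forall g, H g -> exists2 p, p \in P & close (70 * eps) g p),
        (forall x, x \in A -> exists2 h, H h & close 0 (px x) (u * h)%g) /\
          (forall y, y \in D -> exists2 h, H h & close (2 * eps) (py y) (h * v)%g)
      & (forall z, z \in C ->
           (exists x y, [/\ x \in A, y \in D & close eps (pz z) (px x * py y)%g]) /\
           (exists2 h, H h & close (73 * eps) (pz z) (u * w * h * v)%g)) /\
        delta ^+ 371 * N ^+ 2 <= #|[set p | [&& p.1 \in A, p.2 \in D &
          [exists z in C, close eps (px p.1 * py p.2)%g (pz z)]]]%SET|%:R].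
Proof.
have d0 := delta_gt0; have d1 := delta_lt; have N0 := N_gt0; have e0 := eps_gt0.
have [B [B_ge B_deg B_words]] := popular_products.
have [u [A [A_ge A_prop]]] := popular_translate B_ge B_deg.
have A_pop x (xA : x \in A) := (A_prop x xA).1.
have A_deg x (xA : x \in A) := (A_prop x xA).2.
have pop1 := popular1 B_ge.
have [K [K_le K_cov]] := power4_covering B_ge B_words A_ge A_pop.
have [P [P_le P_net]] := power2_net B_ge B_words.
have [v [D [D_close D_edges]]] := right_translate A_ge A_pop A_deg.
set S := power (popular B) in K_cov P_net D_close.
set F := [set p | _]%SET in D_edges.
(* For an edge [(x, y)] with [y] near [h v], the element [u^-1 x h] lies in the third, hence the
   fourth, power, so some [k] in [K] covers it and [x y] is near [u k f v]. The most popular [k]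
   becomes [w]. *)
pose near (k : K) (p : X * Y) :=
  `[< exists2 h, S 2 h & close (72 * eps) (px p.1 * py p.2)%g (px u * val k * h * py v)%g >].
have F_near p : p \in F -> exists k, near k p.
  rewrite inE => /and3P[pA pD _]; have [h Sh ch] := D_close _ pD.
  have S3 : S 4 ((px u)^-1 * px p.1 * h)%g.
    apply: (power_le pop1 (m := 3)) => //.
    exact: (power_mul (power1 (A_pop _ pA)) Sh).
  have [k kK [f Sf cf]] := K_cov _ S3.
  exists [` kK]%fset; apply/asboolP; exists f => //=.
  rewrite (_ : 72 * eps = 2 * eps + 70 * eps); last by ring.
  apply: (@close_trans (px p.1 * (h * py v))%g); first by rewrite close_mul2l.
  rewrite -[X in close _ _ X]mulgA.
  by rewrite mulgA -(mulVKg (px u) (px p.1)) -!mulgA close_mul2l !mulgA close_mul2r.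
have K0 : (0 < #|{: K}|)%N.
  have : 0 < #|F|%:R :> R.
    by apply: lt_le_trans D_edges; rewrite mulr_gt0 // exprn_gt0.
  by rewrite ltr0n => /card_gt0P[p /F_near[k _]]; apply/card_gt0P; exists k.
have [w hw] := popular_fibre (R := R) K0 F_near.
set Fw := [set p in F | near w p]%SET in hw.
have Fw_ge : delta ^+ 371 * N ^+ 2 <= #|Fw|%:R.
  rewrite -cardfE in hw.
  have h1 := ler_wpM2l (delta_exp_ge0 270) (le_trans D_edges hw).
  have h2 := ler_wpM2r (ler0n R #|Fw|) K_le.
  rewrite (_ : _ * N ^+ 2 = delta ^+ 270 * (delta ^+ 101 * N ^+ 2)); last by ring.
  by lra.
pose lab (p : X * Y) := label p.1 p.2.
have Fw_F p : p \in Fw -> [/\ p.1 \in A, p.2 \in D, E p.1 p.2 & near w p].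
  by rewrite finset.in_set => /andP[+ nw]; rewrite finset.in_set => /and3P[pA pD pE]; split.
(* [H] is the square of the popular set, so that products of two of its elements fall in the fourth
   power covered by [K]. The labels of the edges kept for [w] form [C]. *)
exists A, D, (lab @: Fw)%SET, (S 2 : set G), (px u), (py v), (val w), K, P; split.
- split => //.
    have FD : #|F|%:R <= #|X|%:R * #|D|%:R :> R.
      rewrite -natrM ler_nat -cardsT -cardsX; apply/subset_leq_card/fintype.subsetP => p.
      by rewrite !inE => /and3P[_ -> _].
    have h1 := ler_wpM2l (ltW d0) (le_trans D_edges FD).
    have h2 := ler_wpM2r (ler0n R #|D|) deltaX_le.
    rewrite -(ler_pM2r N0)
      (_ : delta ^+ 102 * N * N = delta * (delta ^+ 101 * N ^+ 2)); last by ring.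
    by lra.
  (* An edge is determined by its endpoint in [X] and its label. *)
  have FC : #|Fw|%:R <= #|X|%:R * #|lab @: Fw|%SET%:R :> R.
    rewrite -natrM ler_nat -cardsT -cardsX -(@card_in_imset _ _ (fun p => (p.1, lab p))).
      apply/subset_leq_card/fintype.subsetP => _ /imsetP[p pF ->].
      by rewrite !inE /= imset_f.
    move=> [x y] [x' y'] /Fw_F[_ _ + _] /Fw_F[_ _ + _] [xx' e] /=.
    by rewrite -{x'}xx' in e * => Ey Ey'; congr pair; exact: (label_injr Ey Ey' e).
  have h1 := ler_wpM2l (ltW d0) (le_trans Fw_ge FC).
  have h2 := ler_wpM2r (ler0n R #|lab @: Fw|%SET) deltaX_le.
  rewrite -(ler_pM2r N0)
      (_ : delta ^+ 372 * N * N = delta * (delta ^+ 371 * N ^+ 2)); last by ring.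
  by lra.
- split => // g h Sg Sh; exact/K_cov/(power_mul Sg Sh).
- by split.
- split => // x xA; exists ((px u)^-1 * px x)%g; last by rewrite mulVKg closexx.
  exact/(power_le pop1 (m := 1))/power1/A_pop.
split.
  move=> _ /imsetP[p /Fw_F[pA pD pE /asboolP[h Sh ch]] ->]; have c := labelP pE.
  split; first by exists p.1, p.2; rewrite close_sym.
  exists h => //; rewrite (_ : 73 * eps = eps + 72 * eps); last by ring.
  by apply: close_trans ch; rewrite close_sym.
apply: (le_trans Fw_ge); rewrite ler_nat; apply/subset_leq_card/fintype.subsetP => p pF.
have [pA pD pE _] := Fw_F p pF; rewrite inE pA pD /=.
by apply/exists_inP; exists (lab p); [exact: imset_f | exact: labelP].
Qed.

End Core.

End Closeness.

(** * Transfer to finite subsets of the group *)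

Local Open Scope classical_set_scope.

Definition fimage (T : finType) (K : choiceType) (f : T -> K) (A : {set T}) : {fset K} :=
  [fset f t | t in A]%fset.

Lemma card_fimage (T : finType) (K : choiceType) (f : T -> K) (A : {set T}) :
  injective f -> #|` fimage f A| = #|A|.
Proof. by move=> f_inj; rewrite card_imfset //= -cardE. Qed.

Lemma fimageP (T : finType) (K : choiceType) (f : T -> K) (A : {set T}) k :
  reflect (exists2 t, t \in A & k = f t) (k \in fimage f A).
Proof. exact: imfsetP. Qed.

Lemma fimage_val_sub (K : choiceType) (X : {fset K}) (A : {set X}) :
  (fimage val A `<=` X)%fset.
Proof. by apply/fsubsetP => _ /fimageP[x _ ->]; exact: valP. Qed.

Theorem theoremA14 (R : realType) :
  exists C c0 : R, 1 <= C /\ 0 < c0 /\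
  forall (G : groupType) (d : G -> G -> \bar R), biinvariant_metric d ->
  forall (X Y Z : {fset G}) (delta eps : R),
    X != fset0 -> Y != fset0 ->
    one_separated d X -> one_separated d Y -> one_separated d Z ->
    0 < delta -> delta < 1 / 100 ->
    0 < eps -> eps < c0 ->
    #|` Z|%:R <= delta^-1 * Num.sqrt #|` X|%:R * Num.sqrt #|` Y|%:R ->
    delta * #|` X|%:R * #|` Y|%:R <= #|` close_pairs d eps X Y Z|%:R ->
  exists (X'' Y'' Z'' : {fset G}) (H : set G) (u v w : G),
    (X'' `<=` X)%fset /\ (Y'' `<=` Y)%fset /\ (Z'' `<=` Z)%fset /\
    delta `^ C * #|` X|%:R <= #|` X''|%:R /\
    delta `^ C * #|` Y|%:R <= #|` Y''|%:R /\
    delta `^ C * #|` Z|%:R <= #|` Z''|%:R /\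
    rough_approx_subgroup d (delta `^ (- C)) (C * eps) H /\
    (covering_number d (C * eps) H <=
      (delta `^ (- C) * Num.sqrt #|` X|%:R * Num.sqrt #|` Y|%:R)%:E)%E /\
    [set` X''] `<=` nbhd d (C * eps) (mulset [set u] H) /\
    [set` Y''] `<=` nbhd d (C * eps) (mulset H [set v]) /\
    [set` Z''] `<=` nbhd d eps (mulset [set` X''] [set` Y'']) `&`
                    nbhd d (C * eps) (mulset (mulset [set (u * w)%g] H) [set v]) /\
    delta `^ C * #|` X''|%:R * #|` Y''|%:R <=
      #|` close_pairs d eps X'' Y'' Z''|%:R.
Proof.
(* The value 400 exceeds both every exponent of [delta] that arises, at most 373, and every multiple
   of [eps], at most 73. The bound [1 / 1000] keeps the radii used with separation below 1. *)
exists 400, (1 / 1000); split; first lra; split; first lra.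
move=> G d hd X Y Z delta eps X0 Y0 sX sY _ d0 d1 e0 e1 Zle dense.
have sep (W : {fset G}) : one_separated d W -> forall r (x x' : W), r < 1 ->
    close d r (val x) (val x') -> x = x'.
  move=> sW r x x' r1 c; apply/eqP; apply: contraT => /eqP xx'.
  have : (1 <= d (val x) (val x'))%E.
    by apply: sW; [exact: valP | exact: valP | move=> /val_inj].
  by move=> /le_trans/(_ c); rewrite lee_fin leNgt r1.
pose T := [set p : X * Y | [exists z : Z, close d eps (val p.1 * val p.2)%g (val z)]]%SET.
have dense_T : delta * #|` X|%:R * #|` Y|%:R <= #|T|%:R.
  apply: (le_trans dense); rewrite ler_nat.
  rewrite -(@card_fimage _ _ (fun p : X * Y => (val p.1, val p.2))); last first.
    by move=> [a b] [a' b'] [/val_inj -> /val_inj ->].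
  apply/fsubset_leq_card/fsubsetP => -[x y].
  rewrite !inE /= => /andP[/andP[xX yY] /dist_to_close[z zZ c]].
  apply/fimageP; exists ([` xX]%fset, [` yY]%fset) => //.
  by rewrite inE; apply/existsP; exists [` zZ]%fset.
have X1 : (0 < #|{: X}|)%N by rewrite -cardfE cardfs_gt0.
have Y1 : (0 < #|{: Y}|)%N by rewrite -cardfE cardfs_gt0.
have [z0] : exists z : Z, True.
  have : 0 < #|T|%:R :> R.
    by apply: lt_le_trans dense_T; rewrite !cardfE !mulr_gt0 ?ltr0n.
  by rewrite ltr0n => /card_gt0P[p]; rewrite inE => /existsP[z _]; exists z.
move=> _; rewrite !cardfE in dense_T Zle.
have dX : delta * #|{: X}|%:R <= #|{: Z}|%:R.
  exact: (deltaX_le hd z0 (sep X sX) e0 e1 Y1 dense_T).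
have dY : delta * #|{: Y}|%:R <= #|{: Z}|%:R.
  exact: (deltaY_le hd z0 (sep Y sY) e0 e1 X1 dense_T).
have [A [D [C [H [u [v [w [K [P [[A_ge D_ge C_ge] [K_le K_cov] [P_le P_net] [A_sub D_sub]
  [C_sub E_ge]]]]]]]]]]] :=
  finite_structure hd z0 (sep X sX) (sep Y sY) d0 d1 e0 e1 X1 Y1 dense_T Zle.
have dexp m n : (m <= n)%N -> delta ^+ n <= delta ^+ m.
  by move=> mn; apply: ler_wiXn2l mn; lra.
have dge0 n : 0 <= delta ^+ n by exact/exprn_ge0/ltW.
have dgt0 n : 0 < delta ^+ n by exact: exprn_gt0.
have powE : delta `^ 400 = delta ^+ 400 by rewrite powR_mulrn // ltW.
rewrite powRN powE.
exists (fimage val A), (fimage val D), (fimage val C), H, u, v, w.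
rewrite !card_fimage ?(cardfE X) ?(cardfE Y) ?(cardfE Z); try exact: val_inj.
do 3 (split; first exact: fimage_val_sub).
split.
  apply: le_trans A_ge; apply: le_trans (ler_wpM2l (dge0 25) dX).
  by rewrite mulrA -exprSr ler_wpM2r ?dexp.
split.
  apply: le_trans D_ge; apply: le_trans (ler_wpM2l (dge0 102) dY).
  by rewrite mulrA -exprSr ler_wpM2r ?dexp.
split.
  by apply: le_trans C_ge; rewrite ler_wpM2r ?dexp.
split.
  exists K; split.
    rewrite -div1r ler_pdivlMr //; apply: le_trans K_le.
    by rewrite ler_wpM2l ?dexp.
  move=> _ [a Ha [b Hb <-]]; have [k kK [f Hf c]] := K_cov a b Ha Hb.
  apply: (@close_nbhd _ _ _ _ _ (k * f)%g); first by exists k => //; exists f.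
  by apply: close_le c; lra.
split.
  (* The net is at distance at most [70 * eps], strictly below [400 * eps] as [covering_number]
     demands. Its size costs [delta ^+ 245] relative to [N], and the bound on [N] costs one more
     factor [delta]. *)
  apply: (@le_trans _ _ (#|` P|%:R)%:E).
    apply: ereal_inf_lbound; exists P => // g /P_net[p pP c]; exists p => //.
    by apply: (le_lt_trans c); rewrite lte_fin; lra.
  rewrite lee_fin -mulrA mulrC ler_pdivlMr //.
  apply: (@le_trans _ _ (#|` P|%:R * delta ^+ 246)).
    by rewrite ler_wpM2l ?dexp.
  rewrite exprSr mulrA; apply: le_trans (ler_wpM2r (ltW d0) (le_trans P_le Zle)) _.
  by rewrite mulrC !mulrA divff ?gt_eqF // mul1r.
split.
  move=> _ /fimageP[x xA ->]; have [h Hh c] := A_sub x xA.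
  apply: (@close_nbhd _ _ _ _ _ (u * h)%g); first by exists u => //; exists h.
  by apply: close_le c; lra.
split.
  move=> _ /fimageP[y yD ->]; have [h Hh c] := D_sub y yD.
  apply: (@close_nbhd _ _ _ _ _ (h * v)%g); first by exists h => //; exists v.
  by apply: close_le c; lra.
split.
  move=> _ /fimageP[z zC ->]; have [[x [y [xA yD c]]] [h Hh ch]] := C_sub z zC; split.
    apply: close_nbhd c; exists (val x); first by apply/fimageP; exists x.
    by exists (val y) => //; apply/fimageP; exists y.
  apply: (@close_nbhd _ _ _ _ _ (u * w * h * v)%g); last by apply: close_le ch; lra.
  by exists (u * w * h)%g; [exists (u * w)%g => //; exists h | exists v].
(* Two factors [delta] are spent on replacing [#|X|] and [#|Y|] by [N]. *)
apply: (@le_trans _ _ (delta ^+ 371 * #|{: Z}|%:R ^+ 2)).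
  rewrite (_ : delta ^+ 400 = delta ^+ 398 * (delta * delta)); last by ring.
  rewrite -mulrA -mulrA ler_pM ?dexp ?dge0 ?mulr_ge0 ?ler0n ?(ltW d0) //.
  rewrite mulrACA expr2 ler_pM ?mulr_ge0 ?ler0n ?(ltW d0) //.
    by apply: le_trans dX; rewrite ler_wpM2l ?(ltW d0) // ler_nat max_card.
  by apply: le_trans dY; rewrite ler_wpM2l ?(ltW d0) // ler_nat max_card.
apply: (le_trans E_ge); rewrite ler_nat; set Q := [set p | _]%SET.
rewrite -(@card_fimage _ _ (fun p : X * Y => (val p.1, val p.2)) Q); last first.
  by move=> [a b] [a' b'] [/val_inj -> /val_inj ->].
apply/fsubset_leq_card/fsubsetP => _ /fimageP[[x y] + ->].
rewrite finset.in_set /= => /and3P[xA yD /exists_inP[z zC c]].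
have zC' : val z \in fimage val C by apply/fimageP; exists z.
by rewrite !inE /= xA yD; exact: close_nbhd zC' c.
Qed.
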